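(* For every $k\ge 3$, the exponential cube $\Omega_k$ is a maximally connected and super edge-connected $k$-regular Hamiltonian graph of order $2^{2^k-1}$ with diameter $3\cdot 2^{k-1}-2$.
   Context: A graph means a finite simple undirected graph with at least one vertex; its order is its number of vertices. $\delta(G)$ is the minimum degree of $G$ and $N_G(u)$ the set of neighbours of $u$. The connectivity $\kappa(G)$ is the minimum number of vertices whose removal from $G$ results in a disconnected graph or a graph with one vertex. $G$ is maximally connected if $\kappa(G)=\delta(G)$. For a connected graph $G$, a set $F\subseteq E(G)$ is an edge-cut if $G-F$ is disconnected; $G$ is super edge-connected if for every edge-cut $F$ of minimum cardinality there is a vertex $u$ with $\deg_G(u)=\delta(G)$ and $F=\{uv\in E(G): v\in N_G(u)\}$. $G$ is Hamiltonian if it has a cycle (of length at least 3) containing every vertex. The diameter is the maximum distance between two vertices. Exponential graph: for graphs $G$ and $H$ with $V(H)=\{w_1,\ldots,w_q\}$, the exponential graph $G^H$ has vertex set $\{(u_1,\ldots,u_q;w_j) : u_i\in V(G)\ (1\le i\le q),\ 1\le j\le q\}$, and two vertices $(u_1,\ldots,u_q;w_j)$ and $(v_1,\ldots,v_q;w_k)$ are adjacent if and only if either ($j=k$, $u_jv_j\in E(G)$, and $u_i=v_i$ for all $i\ne j$) or ($j\neq k$, $w_jw_k\in E(H)$, and $u_i=v_i$ for all $i$). Exponential cube: $\Omega_1=K_2$ (the complete graph on two vertices) and $\Omega_k=(\Omega_{k-1})^{K_2}$ for $k\ge 2$. *)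

(* Defs.v *)
From mathcomp Require Import all_boot.

Set Implicit Arguments.
Unset Strict Implicit.
Unset Printing Implicit Defensive.

Record graph := Graph {
  vert :> finType;
  adj : rel vert;
  adj_sym : symmetric adj;
  adj_irr : irreflexive adj;
  vert_gt0 : 0 < #|vert| }.

Definition connected_rel (T : finType) (e : rel T) : bool :=
  [forall x, forall y, connect e x y].

Section Invariants.
Variable G : graph.

Definition nbr (u : G) : {set G} := [set v | adj u v].
Definition deg (u : G) : nat := #|nbr u|.

(* The default value #|G| of the minimum is harmless: G is nonempty and every
   degree is smaller than #|G|. *)
Definition min_deg : nat := \big[minn/#|G|]_(u : G) deg u.

Definition regular (d : nat) : Prop := forall u : G, deg u = d.

Definition connected : bool := connected_rel (@adj G).

Definition del_vertices (S : {set G}) : rel {u : G | u \notin S} :=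
  fun x y => adj (val x) (val y).

(* S = [set: G] does not qualify: the empty relation on the empty type is
   connected in the sense of connected_rel. *)
Definition vertex_cut (S : {set G}) : bool :=
  ~~ connected_rel (del_vertices (S := S)) || (#|~: S| == 1).

(* The default value #|G| of the minimum is never reached: removing all
   vertices but one always gives a cut. *)
Definition connectivity : nat := \big[minn/#|G|]_(S | vertex_cut S) #|S|.

Definition maximally_connected : Prop := connectivity = min_deg.

Definition edges : {set {set G}} :=
  [set e | [exists x, exists y, adj x y && (e == [set x; y])]].

Definition del_edges (F : {set {set G}}) : rel G :=
  fun x y => adj x y && ([set x; y] \notin F).

Definition edge_cut (F : {set {set G}}) : bool :=
  (F \subset edges) && ~~ connected_rel (del_edges F).

Definition super_edge_connected : Prop :=
  connected /\
  forall F : {set {set G}},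
    edge_cut F ->
    (forall F' : {set {set G}}, edge_cut F' -> #|F| <= #|F'|) ->
    exists2 u : G, deg u = min_deg & F = [set [set u; v] | v in nbr u].

Definition hamiltonian : Prop :=
  exists c : seq G,
    [/\ 3 <= size c, cycle (@adj G) c, uniq c & forall u : G, u \in c].

(* Length of a shortest path; between two connected vertices it is smaller
   than #|G|, and #|G| is the value for vertices that are not connected. *)
Definition dist (x y : G) : nat :=
  \big[minn/#|G|]_(n < #|G| |
      [exists p : n.-tuple G, path (@adj G) x p && (last x p == y)]) n.

Definition diameter : nat := \max_(x : G) \max_(y : G) dist x y.

End Invariants.

Section Exponential.
Variables G H : graph.

(* A vertex (u_1, ..., u_q; w_j) is a pair (u, w) with u : {ffun H -> G}, the
   coordinates of u being indexed by the vertices of H themselves. *)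
Definition exp_adj (x y : {ffun H -> G} * H) : bool :=
  let: (u, j) := x in let: (v, k) := y in
  [&& j == k, adj (u j) (v j) & [forall i, (i != j) ==> (u i == v i)]]
  || [&& j != k, adj j k & [forall i, u i == v i]].

Lemma exp_adj_sym : symmetric exp_adj.
Proof.
move=> [u j] [v k] /=; rewrite (eq_sym k j) (adj_sym k j).
have -> : [forall i, v i == u i] = [forall i, u i == v i].
  by apply: eq_forallb => i; rewrite eq_sym.
congr orb; case: eqP => [<-|//] /=; rewrite adj_sym; congr andb.
by apply: eq_forallb => i; rewrite (eq_sym (v i)).
Qed.

Lemma exp_adj_irr : irreflexive exp_adj.
Proof. by move=> [u j] /=; rewrite eqxx adj_irr. Qed.

Lemma exp_vert_gt0 : 0 < #|{: {ffun H -> G} * H}|.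
Proof. by rewrite card_prod card_ffun muln_gt0 expn_gt0 !vert_gt0. Qed.

Definition exp_graph : graph := Graph exp_adj_sym exp_adj_irr exp_vert_gt0.

End Exponential.

Definition K2_adj : rel bool := fun x y => x != y.

Lemma K2_adj_sym : symmetric K2_adj.
Proof. by move=> x y; rewrite /K2_adj eq_sym. Qed.

Lemma K2_adj_irr : irreflexive K2_adj.
Proof. by move=> x; rewrite /K2_adj eqxx. Qed.

Lemma K2_vert_gt0 : 0 < #|{: bool}|.
Proof. by rewrite card_bool. Qed.

Definition K2 : graph := Graph K2_adj_sym K2_adj_irr K2_vert_gt0.

(* exp_cube 1 = K2 and exp_cube k.+2 = exp_graph (exp_cube k.+1) K2; the value
   exp_cube 0 = K2 is a dummy. *)
Definition exp_cube (k : nat) : graph :=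
  iter k.-1 (fun G => exp_graph G K2) K2.

(* Main.v *)
Require Import Defs.
From mathcomp Require Import all_boot.
From mathcomp Require Import zify.

(** A cut is encoded as a partial 2-colouring of the vertices, deleted vertices
    being uncoloured; its defects are the deleted vertices and the edges joining
    the two colours.  The graph [G^K2] consists of copies of [G] in two
    directions, any two copies of different directions being joined by exactly
    one edge, as in [K_(n,n)] with [n = #|G|].  If every colouring of [G]
    using both colours has at least [d] defects and one of [G^K2] has fewer than [2d] and
    fewer than [n] of them, then exactly one copy carries both colours; all the
    rest has one colour, and every vertex of the other colour costs a further
    defect through its cross edge.  Hence [G^K2] needs [d + 1] defects, which
    bounds both kinds of connectivity, and an edge cut with only [d + 1] edges
    isolates a single vertex.  A Hamiltonian cycle of [G] lifts by running through
    each copy once, and the diameter satisfies [D' = 2 D + 2], the extremal pair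
    being [(x, x; w)] and [(y, y; w)] with [x], [y] at distance [D]. *)

Set Implicit Arguments.
Unset Strict Implicit.
Unset Printing Implicit Defensive.

(** * Copies of [G] inside [G^K2], degrees and order *)

Section ExpK2.
Variable G : graph.

Definition pair_at (j : K2) (x t : G) : {ffun K2 -> G} :=
  [ffun i => if i == j then x else t].

(** The copies of [G] in the two directions; [t] is the coordinate held fixed. *)
Definition layer (j : K2) (t x : G) : exp_graph G K2 := (pair_at j x t, j).

Lemma pair_at_id j x t : pair_at j x t j = x.
Proof. by rewrite ffunE eqxx. Qed.

Lemma pair_at_neg (j : bool) x t : pair_at j x t (~~ j) = t.
Proof. by rewrite ffunE; case: j. Qed.

Lemma pair_atC (j : bool) x t : pair_at (~~ j) x t = pair_at j t x.
Proof. by apply/ffunP => i; rewrite !ffunE; case: j; case: i. Qed.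

Lemma pair_at_eta (j : bool) (u : {ffun K2 -> G}) :
  pair_at j (u j) (u (~~ j)) = u.
Proof. by apply/ffunP => i; rewrite !ffunE; case: j; case: i. Qed.

Lemma layer_eta (u : {ffun K2 -> G}) (j : bool) :
  layer j (u (~~ j)) (u j) = (u, j).
Proof. by rewrite /layer pair_at_eta. Qed.

Lemma layer_inj j t : injective (layer j t).
Proof.
move=> x y /(congr1 (fun v : exp_graph G K2 => v.1 j)).
by rewrite /= !pair_at_id.
Qed.

Lemma adj_layer j t x y :
  @adj (exp_graph G K2) (layer j t x) (layer j t y) = adj x y.
Proof.
rewrite /layer /= !pair_at_id eqxx /= orbF andbC.
rewrite (_ : [forall i, _]) //; apply/forallP => i.
by apply/implyP => /negbTE ne; rewrite !ffunE ne.
Qed.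

Lemma adj_cross (u : {ffun K2 -> G}) (j : bool) :
  @adj (exp_graph G K2) (u, j) (u, ~~ j).
Proof.
have -> : @adj (exp_graph G K2) (u, j) (u, ~~ j) = exp_adj (u, j : K2) (u, ~~ j : K2) by [].
have h : [forall i, u i == u i] by apply/forallP.
by rewrite /exp_adj h; case: j.
Qed.

Lemma adj_expE (u v : {ffun K2 -> G}) (j k : bool) :
  @adj (exp_graph G K2) (u, j) (v, k) ->
  (k = j /\ exists2 y, adj (u j) y & v = pair_at j y (u (~~ j)))
  \/ (k = ~~ j /\ v = u).
Proof.
case/orP => /and3P[/eqP jk a /forallP uv]; [left|right].
  rewrite -{}jk in a *; split=> //; exists (v j) => //.
  rewrite -[LHS](pair_at_eta j); congr pair_at.
  by have := uv (~~ j); case: (j) => /= /eqP.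
split; first by case: (j) (k) jk => -[].
by apply/ffunP => i; rewrite (eqP (uv i)).
Qed.

Lemma regular_exp d : regular G d -> regular (exp_graph G K2) d.+1.
Proof.
move=> regG [u j]; rewrite /deg.
have -> : nbr ((u, j) : exp_graph G K2) =
    ((u, ~~ j) : exp_graph G K2) |: [set layer j (u (~~ j)) x | x in nbr (u j)].
  apply/setP => -[v k]; rewrite !inE; apply/idP/idP.
    case/adj_expE => -[-> ].
      by case=> y a ->; rewrite imset_f ?orbT // inE.
    by move=> ->; rewrite eqxx.
  case/orP => [/eqP[-> ->]|]; first exact: adj_cross.
  case/imsetP => x; rewrite inE => a ->.
  by rewrite -[X in adj X](layer_eta u j) adj_layer.
rewrite cardsU1 card_imset; last exact: layer_inj.
rewrite -[#|nbr _|]/(deg _) regG; case: imsetP => //= -[x _ [_]].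
by case: (j).
Qed.

Lemma card_exp : #|exp_graph G K2| = #|G| ^ 2 * 2.
Proof. by rewrite card_prod card_ffun card_bool. Qed.

End ExpK2.

(** * Partial 2-colourings and their defects *)

Section Defects.
Variable G : graph.
Implicit Type f : G -> option bool.

(* A mixed cut is a 2-colouring in which deleted vertices get the colour None;
   a deleted vertex x is recorded as the pair (x, x), a cut edge as the pair
   going from colour true to colour false. *)
Definition defects f : {set G * G} :=
  [set p | (p.1 == p.2) && (f p.1 == None) ||
           [&& adj p.1 p.2, f p.1 == Some true & f p.2 == Some false]].

Definition has_colour f s := [exists x, f x == Some s].

Definition bicoloured f := has_colour f true && has_colour f false.

Lemma bicolouredP f s : bicoloured f -> exists x, f x = Some s.
Proof.
by case/andP => /existsP[x /eqP ?] /existsP[y /eqP ?]; case: s; [exists x|exists y].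
Qed.

Lemma not_bicoloured f x :
  ~~ bicoloured f -> f x != Some (~~ has_colour f true).
Proof.
rewrite /bicoloured /has_colour negb_and.
case: existsP => /= [h /existsPn ->//|h _].
by apply/negP => e; apply: h; exists x.
Qed.

Lemma defect_edge f x y s :
  adj x y -> f x = Some s -> f y = Some (~~ s) ->
  exists2 p, p \in defects f & p = (x, y) \/ p = (y, x).
Proof.
move=> a fx fy; case: s fx fy => fx fy.
  by exists (x, y); rewrite ?inE /= ?a ?fx ?fy ?orbT; [|left].
by exists (y, x); rewrite ?inE /= 1?adj_sym ?a ?fx ?fy ?orbT; [|right].
Qed.

(** Counting deleted vertices and cut edges together lets one induction serve both kinds of
    connectivity. *)
Definition cut_bound d := forall f, bicoloured f -> d <= #|defects f|.

End Defects.

(** * Colourings of [G^K2] with few defects *)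

Section CutStep.
Variable G : graph.
Variable f : exp_graph G K2 -> option bool.

Let layer_col (j : bool) t : G -> option bool := fun x => f (layer j t x).

(** The cross edge over [u], or one of its two ends, is a defect. *)
Definition mixed (u : {ffun K2 -> G}) :=
  (f (u, true) == None) || (f (u, true) != f (u, false)).

Lemma mixedPn u : ~~ mixed u -> exists s, forall i : bool, f (u, i) = Some s.
Proof.
rewrite /mixed negb_or negbK => /andP[]; case e: (f _) => [s|//] _ /eqP e'.
by exists s => -[].
Qed.

Lemma mixed_defect u : mixed u ->
  exists2 p, p \in defects f & p.1.1 = u /\ p.2.1 = u.
Proof.
rewrite /mixed; case e: (f (u, true)) => [s|] /=; last first.
  by exists ((u, true), (u, true)); rewrite ?inE //= eqxx e.
case e': (f (u, false)) => [s'|] /= ne; last first.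
  by exists ((u, false), (u, false)); rewrite ?inE //= eqxx e'.
have ss : s' = ~~ s by case: (s) (s') ne => -[].
rewrite ss in e'.
by have [p pD [pe|pe]] := defect_edge (adj_cross u true) e e';
  exists p; rewrite // pe.
Qed.

(* Two oppositely coloured copies of G, one of each direction, meet in a mixed
   pair; hence few mixed pairs force all copies to have one colour. *)
Lemma one_colour (j : bool) (R : {set G}) :
  (forall c, ~~ bicoloured (layer_col (~~ j) c)) ->
  (forall r, r \in R -> ~~ bicoloured (layer_col j r)) ->
  #|[set u : {ffun K2 -> G} | (u (~~ j) \in R) && mixed u]| < #|R| ->
  exists s, forall (u : {ffun K2 -> G}) (i : bool),
    (i == j -> u (~~ j) \in R) -> f (u, i) != Some (~~ s).
Proof.
move=> colN rowN small.
(* The only colour that a layer which is not bicoloured can carry; a fully deleted layer gets the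
   default [false]. *)
pose tau (i : bool) t := has_colour (layer_col i t) true.
have mixI r c : r \in R -> tau j r != tau (~~ j) c -> mixed (pair_at j c r).
  move=> rR; apply: contraR => /mixedPn[s fs].
  have := not_bicoloured c (rowN r rR); rewrite /layer_col /layer fs.
  have := not_bicoloured r (colN c); rewrite /layer_col /layer pair_atC fs.
  rewrite /tau /layer_col.
  by case: (has_colour _ _); case: (has_colour _ _); case: (s).
have noR (h : G -> G) : ~ forall r, r \in R -> mixed (pair_at j (h r) r).
  move=> hm; move: small; rewrite ltnNge => /negP[].
  have hi : injective (fun r => pair_at j (h r) r).
    by move=> r r' /(congr1 (fun u : {ffun K2 -> G} => u (~~ j))); rewrite !pair_at_neg.
  rewrite -(card_imset (mem R) hi); apply: subset_leq_card.
  by apply/subsetP => _ /imsetP[r rR ->]; rewrite inE pair_at_neg rR hm.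
have noC r : r \in R -> ~ forall c, mixed (pair_at j c r).
  move=> rR hm; move: small; rewrite ltnNge => /negP[].
  have hi : injective (fun c => pair_at j c r).
    by move=> c c' /(congr1 (fun u : {ffun K2 -> G} => u j)); rewrite !pair_at_id.
  apply: leq_trans (max_card _) _; rewrite -cardsT -(card_imset _ hi).
  apply: subset_leq_card.
  by apply/subsetP => _ /imsetP[c _ ->]; rewrite inE pair_at_neg rR hm.
(* If two columns differed, every row in [R] would disagree with one of them, giving [#|R|] distinct
   mixed pairs. *)
have colE c c' : tau (~~ j) c = tau (~~ j) c'.
  have [//|ne] := eqVneq (tau (~~ j) c) (tau (~~ j) c').
  case: (noR (fun r => if tau j r == tau (~~ j) c then c' else c)) => r rR.
  by apply: mixI => //; case: (tau j r =P tau (~~ j) c) => [->|/eqP].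
have [c0 _] := card_gt0P (vert_gt0 G).
(* A row disagreeing with the common column colour would be mixed throughout, giving [#|G|] mixed
   pairs. *)
have rowE r : r \in R -> tau j r = tau (~~ j) c0.
  move=> rR; have [//|ne] := eqVneq (tau j r) (tau (~~ j) c0).
  by case: (noC r rR) => c; apply: mixI => //; rewrite (colE c c0).
exists (tau (~~ j) c0) => u i; case: (i =P j) => [-> /(_ isT) uR|/eqP ne _].
  rewrite -(rowE _ uR) -layer_eta.
  exact: (@not_bicoloured _ (layer_col j (u (~~ j)))) (rowN _ uR).
have {ne} -> : i = ~~ j by case: (i) (j) ne => -[].
rewrite -(colE (u j)) -layer_eta negbK.
exact: (@not_bicoloured _ (layer_col (~~ j) (u j))) (colN _).
Qed.

Lemma small_colour_class d :
  cut_bound G d -> bicoloured f -> #|defects f| < #|G| -> #|defects f| < d.*2 ->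
  exists s, d + #|[set v | f v == Some s]| <= #|defects f|.
Proof.
move=> GP fP ltG lt2.
have cardD (D : {set exp_graph G K2 * exp_graph G K2}) (M : {set {ffun K2 -> G}}) :
    (forall u, u \in M -> exists2 p, p \in D & p.1.1 = u) -> #|M| <= #|D|.
  move=> sM; pose base (p : exp_graph G K2 * exp_graph G K2) := p.1.1.
  apply: leq_trans (leq_imset_card base (mem D)); apply: subset_leq_card.
  by apply/subsetP => u /sM[p pD <-]; apply: (imset_f base).
have [/existsP[j /existsP[t bjt]]|none] :=
  boolP [exists j : bool, exists t, bicoloured (layer_col j t)]; last first.
  (* Without a bicoloured layer, [one_colour] for all rows gives a single colour everywhere, against
     [fP]. *)
  have nb j t : ~~ bicoloured (layer_col j t).
    by move/existsPn: none => /(_ j)/existsPn/(_ t).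
  have [|s hs] := @one_colour true setT (nb _) (fun r _ => nb _ r).
    rewrite cardsT; apply: leq_ltn_trans ltG; apply: cardD => u.
    by rewrite !inE /= => /mixed_defect[p pD [pu _]]; exists p.
  have [[u i] fu] := bicolouredP (~~ s) fP.
  by have := hs u i; rewrite inE fu eqxx => /(_ (fun _ => isT)).
pose im (i : bool) r : {set exp_graph G K2 * exp_graph G K2} :=
  [set (layer i r p.1, layer i r p.2) | p in defects (layer_col i r)].
have imD i r : im i r \subset defects f.
  apply/subsetP => _ /imsetP[p pD ->]; move: pD; rewrite !inE adj_layer.
  by rewrite (inj_eq (@layer_inj _ _ _)).
have cim i r : bicoloured (layer_col i r) -> d <= #|im i r|.
  move=> /GP; rewrite card_imset // => -[x y] [x' y'] e.
  by have /layer_inj /= -> := congr1 fst e; have /layer_inj /= -> := congr1 snd e.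
(* The defects outside the bicoloured layer; fewer than [d] of them remain, so no second layer can
   be bicoloured. *)
pose D' := defects f :\: im j t.
have cD' : d + #|D'| <= #|defects f|.
  by rewrite -(cardsID (im j t) (defects f)) (setIidPr (imD j t)) leq_add2r cim.
have notim p : p \in defects f -> (p.1.1 (~~ j) != t) || (p.1.2 != j) || (p.2.2 != j) ->
    p \in D'.
  move=> pD h; rewrite inE pD andbT; apply: contraTN h => /imsetP[q _ ->] /=.
  by rewrite pair_at_neg !eqxx.
have nb i r : (i, r) != (j, t) -> ~~ bicoloured (layer_col i r).
  move=> ne; apply/negP => /cim; suff : im i r \subset D'.
      by move/subset_leq_card => a b; lia.
  apply/subsetP => p pim; apply: notim; first exact: subsetP (imD i r) _ pim.
  case/imsetP: pim => q _ -> /=; apply: contraNT ne.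
  rewrite !negb_or !negbK => /andP[/andP[/eqP e /eqP ij] _].
  by rewrite -ij pair_at_neg in e; rewrite e ij.
have [||| s hs] := @one_colour j [set~ t].
- by move=> c; apply: nb; rewrite xpair_eqE; case: (j).
- by move=> r; rewrite !inE => ne; apply: nb; rewrite xpair_eqE eqxx.
- have : #|[set u : {ffun K2 -> G} | (u (~~ j) \in [set~ t]) && mixed u]| <= #|D'|.
    apply: cardD => u; rewrite !inE => /andP[ut /mixed_defect[p pD [pu _]]].
    by exists p => //; apply: notim; rewrite // pu ut.
  (* Here [d] is positive, because [d.*2] exceeds a number of defects; hence [#|D'| < #|G| - 1]. *)
  by have := cardsC1 t; lia.
exists (~~ s); apply: leq_trans cD'; rewrite leq_add2l.
pose M := [set u | f (u, j) == Some (~~ s)].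
have -> : [set v | f v == Some (~~ s)] = [set (u, j) | u in M].
  apply/setP => -[u i]; rewrite inE; apply/idP/imsetP => [e|[u' + [-> ->]]]; last by rewrite inE.
  have ij : i = j.
    by apply/eqP; apply: contraTT e => ij; apply: hs; rewrite (negbTE ij).
  by exists u; rewrite ?inE -?ij.
rewrite card_imset; last by move=> u v [].
apply: cardD => u; rewrite inE => /eqP fu.
(* The cross neighbour [(u, ~~ j)] lies outside the bicoloured layer, so it is deleted or has colour
   [s]; either way [D'] contains a defect over [u]. *)
have jN : (~~ j == j) = false by case: (j).
have := hs u (~~ j); rewrite jN => /(_ (fun e => ltac:(discriminate e))).
case e: (f (u, ~~ j)) => [s'|] ns.
  have e' : f (u, ~~ j) = Some (~~ ~~ s).
    by rewrite e; case: (s') (s) ns => -[].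
  have [p pD [pe|pe]] := defect_edge (adj_cross u j) fu e';
    (exists p; last by rewrite pe); apply: notim; rewrite // pe /= jN ?orbT //.
exists ((u, ~~ j), (u, ~~ j)) => //; apply: notim; last by rewrite /= jN ?orbT.
by rewrite inE /= eqxx e.
Qed.

End CutStep.

(** At most [d] defects would be few enough for [small_colour_class], whose nonempty colour class
    forces one more than [d]. *)
Lemma cut_bound_exp (G : graph) d :
  0 < d < #|G| -> cut_bound G d -> cut_bound (exp_graph G K2) d.+1.
Proof.
case/andP=> d0 dG GP f fP; case: ltnP => // le.
have [||s] := small_colour_class GP fP; [lia|lia|].
have [v fv] := bicolouredP s fP.
have : 0 < #|[set v | f v == Some s]| by apply/card_gt0P; exists v; rewrite inE fv.
lia.
Qed.

Lemma cut_bound_K2 : cut_bound K2 1.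
Proof.
move=> f fP; have [x fx] := bicolouredP true fP.
have [y fy] := bicolouredP false fP.
have a : @adj K2 x y by apply/eqP => e; rewrite e fy in fx.
by have [p pD _] := defect_edge a fx fy; apply/card_gt0P; exists p.
Qed.

(** * Minima over finite families *)

Section BigMin.
Variables (I : eqType) (r : seq I) (P : pred I) (F : I -> nat) (m : nat).

Lemma bigmin_le i : i \in r -> P i -> \big[minn/m]_(j <- r | P j) F j <= F i.
Proof.
elim: r => //= a s IH; rewrite inE big_cons => /predU1P[<- ->|is' Pi].
  exact: geq_minl.
by case: ifP => _; [apply: leq_trans (geq_minr _ _) _|]; apply: IH.
Qed.

Lemma bigmin_attained : let b := \big[minn/m]_(j <- r | P j) F j in
  b = m \/ exists2 i, P i & b = F i.
Proof.
move=> b; rewrite /b; elim/big_ind: _ => [|a c ha hc|i Pi]; first by left.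
  by rewrite /minn; case: ifP.
by right; exists i.
Qed.

End BigMin.

(** * From defect bounds to connectivity *)

Section Connectivity.
Variables (G : graph) (d : nat).
Hypothesis regG : regular G d.

Lemma deg_lt_card (u : G) : deg u < #|G|.
Proof.
rewrite /deg -cardsT; apply: proper_card.
by apply/properP; split=> //; exists u; rewrite ?inE ?adj_irr.
Qed.

Lemma min_deg_regular : min_deg G = d.
Proof.
have [u _] := card_gt0P (vert_gt0 G).
have le := bigmin_le (@deg G) #|G| (mem_index_enum u) (isT : predT u).
have lt := deg_lt_card u; rewrite regG in le lt.
rewrite /min_deg; have [e|[v _ ->//]] := bigmin_attained (index_enum G) predT (@deg G) #|G|.
by rewrite e leqNgt lt in le.
Qed.

Definition star (u : G) : {set {set G}} := [set [set u; v] | v in nbr u].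

Lemma card_star u : #|star u| = d.
Proof.
rewrite card_in_imset; first exact: regG.
move=> v w; rewrite !inE => uv uw e.
have : v \in [set u; w] by rewrite -e !inE eqxx orbT.
by rewrite !inE => /predU1P[vu|/eqP//]; rewrite vu adj_irr in uv.
Qed.

Lemma edge_cut_star u : 1 < #|G| -> edge_cut (star u).
Proof.
move=> G1; apply/andP; split.
  apply/subsetP => _ /imsetP[v uv ->]; rewrite inE in uv.
  by rewrite inE; apply/existsP; exists u; apply/existsP; exists v; rewrite uv /=.
have : 0 < #|[set~ u]| by rewrite cardsC1; lia.
case/card_gt0P => w; rewrite !inE => wu.
apply/forallPn; exists u; apply/forallPn; exists w.
apply/connectP => -[[|z p] /=]; first by move=> _ e; rewrite e eqxx in wu.
by case/andP => /andP[uz]; rewrite (imset_f (fun v => [set u; v])) // inE.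
Qed.

(** One colour is given to a component of the graph without [F], the other to the rest. *)
Lemma edge_cut_colouring F : edge_cut F ->
  exists f : G -> bool,
    [/\ bicoloured (Some \o f),
        forall x y, adj x y -> f x != f y -> [set x; y] \in F &
        #|defects (Some \o f)| <= #|F|].
Proof.
case/andP => _ /forallPn[a /forallPn[b nab]].
pose f := connect (del_edges F) a.
have cut x y : adj x y -> f x -> ~~ f y -> [set x; y] \in F.
  move=> xy ax; apply: contraNT => nF; apply: connect_trans ax _.
  by apply: connect1; rewrite /del_edges xy.
have cutF x y : adj x y -> f x != f y -> [set x; y] \in F.
  move=> xy; case fx: (f x); case fy: (f y) => // _; first by rewrite cut // fy.
  by rewrite setUC cut ?fx // adj_sym.
exists f; split=> //.
  apply/andP; split; apply/existsP; [exists a|exists b] => /=.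
    by rewrite /f connect0.
  by rewrite /f (negbTE nab).
have inD p : p \in defects (Some \o f) -> [/\ adj p.1 p.2, f p.1 & ~~ f p.2].
  by rewrite inE andbF /= => /and3P[-> /eqP[->] /eqP[->]].
(* Defect pairs run from colour [true] to colour [false], so each is determined by its unordered
   edge. *)
have <- : #|[set [set p.1; p.2] | p in defects (Some \o f)]| = #|defects (Some \o f)|.
  apply: card_in_imset => -[x y] [x' y'] /inD[/= _ fx fy] /inD[/= _ fx' fy'] e.
  have : x \in [set x'; y'] by rewrite -e !inE eqxx.
  have : y \in [set x'; y'] by rewrite -e !inE eqxx orbT.
  rewrite !inE => /orP[] /eqP yE /orP[] /eqP xE; rewrite ?xE ?yE //.
  - by rewrite yE fx' in fy.
  - by rewrite yE fx' in fy.
  - by rewrite xE (negbTE fy') in fx.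
apply: subset_leq_card; apply/subsetP => _ /imsetP[p /inD[pa f1 f2] ->].
exact: cut.
Qed.

Lemma cut_bound_connected : 0 < d -> cut_bound G d -> connected G.
Proof.
move=> d0 GP; apply: contraT => nc.
(* In a disconnected graph the empty set is an edge cut, which yields a colouring without
   defects. *)
have [|f [/GP le _]] := @edge_cut_colouring set0; last by rewrite cards0; lia.
apply/andP; split; first exact: sub0set.
apply: contraNN nc => /forallP h; apply/forallP => x; apply/forallP => y.
have /forallP/(_ y) := h x; apply: connect_sub => u v /andP[uv _].
exact: connect1.
Qed.

Lemma vertex_cut_bound (S : {set G}) :
  cut_bound G d -> d < #|G| -> vertex_cut S -> d <= #|S|.
Proof.
move=> GP dG /orP[|/eqP c1]; last by have := cardsC S; lia.
case/forallPn => a /forallPn[b nab].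
(* [insub] fails exactly on [S], so [S] is uncoloured; the component of [a] in the rest gets [true],
   and no edge joins the two colours. *)
pose f (v : G) := omap (connect (del_vertices (S := S)) a) (insub v).
have fS v (vS : v \notin S) : f v = Some (connect (del_vertices (S := S)) a (Sub v vS)).
  by rewrite /f insubT.
apply: (@leq_trans #|defects f|).
  apply: GP; apply/andP; split; apply/existsP.
    by exists (val a); rewrite /f valK /= connect0.
  by exists (val b); rewrite /f valK /= (negbTE nab).
rewrite -[X in _ <= X](card_imset (mem S) (f := fun x => (x, x))); last by move=> x y [].
apply: subset_leq_card; apply/subsetP => -[x y]; rewrite inE /=.
case/orP => [/andP[/eqP<- fx]|/and3P[xy]].
  apply: imset_f; apply: contraLR fx => xS.
  by rewrite (fS _ xS).
case: (boolP (x \in S)) => [xS|xS]; first by rewrite /f insubN ?negbK.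
case: (boolP (y \in S)) => [yS _|yS]; first by rewrite /f insubN ?negbK.
rewrite !fS => /eqP[ax] /eqP[ay]; rewrite (connect_trans ax) // in ay.
exact: connect1.
Qed.

Lemma maximally_connected_regular :
  cut_bound G d -> d.+1 < #|G| -> maximally_connected G.
Proof.
move=> GP dG; rewrite /maximally_connected min_deg_regular.
have dG' : d < #|G| by lia.
apply/eqP; rewrite eqn_leq; apply/andP; split; last first.
  rewrite /connectivity.
  have [->|[S cS ->]] := bigmin_attained (index_enum _) (@vertex_cut G) (fun S => #|S|) #|G|.
    exact: ltnW.
  exact: vertex_cut_bound.
have [u _] := card_gt0P (vert_gt0 G).
rewrite -(regG u); apply: bigmin_le; first exact: mem_index_enum.
have uS : u \notin nbr u by rewrite inE adj_irr.
(* Some [w] lies outside the closed neighbourhood of [u], so deleting the neighbours of [u]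
   separates [u] from [w]. *)
have : 0 < #|~: (u |: nbr u)|.
  have := cardsC (u |: nbr u); rewrite cardsU1 uS -[#|nbr u|]/(deg u) regG; lia.
case/card_gt0P => w; rewrite in_setC in_setU1 negb_or => /andP[wu wS].
apply/orP; left; apply/forallPn; exists (Sub u uS); apply/forallPn; exists (Sub w wS).
apply/connectP => -[[|z p] /=]; first by move=> _ [e]; rewrite e eqxx in wu.
case/andP => uz _ _; have := valP z; rewrite inE.
by move: uz; rewrite /del_vertices /= => ->.
Qed.

End Connectivity.

Lemma super_edge_connected_exp (G : graph) d :
  1 < d -> d.+1 < #|G| -> regular G d -> cut_bound G d ->
  super_edge_connected (exp_graph G K2).
Proof.
move=> d1 dG regG GP.
have regE := regular_exp regG.
have cE : 1 < #|exp_graph G K2| by rewrite card_exp; lia.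
split; first by apply: (@cut_bound_connected _ d.+1) => //; apply: cut_bound_exp => //; lia.
move=> F cF minF.
have [v0 _] := card_gt0P (vert_gt0 (exp_graph G K2)).
have leF : #|F| <= d.+1.
  by rewrite -(card_star regE v0); apply: minF; apply: edge_cut_star.
have [f [fP cutF leD]] := edge_cut_colouring cF.
(* The strict bound [d.+1 < d.*2] comes from [1 < d]. The resulting colour class has at most one
   vertex. *)
have [||s sP] := small_colour_class GP fP; [lia|rewrite -addnn; lia|].
have [u /= [fu]] := bicolouredP s fP.
exists u; first by rewrite (min_deg_regular regE) regE.
apply/esym/eqP; rewrite eqEcard (card_star regE) leF andbT.
apply/subsetP => _ /imsetP[v + ->]; rewrite inE => uv; apply: cutF => //.
apply: contraTN uv => /eqP fuv.
have : #|[set u; v]| <= 1.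
  apply: (@leq_trans #|[set v | (Some \o f) v == Some s]|); last by lia.
  apply: subset_leq_card; apply/subsetP => w; rewrite !inE /=.
  by case/orP => /eqP->; rewrite -?fuv fu.
rewrite cards2; case: eqP => // <- _.
by rewrite adj_irr.
Qed.

(** * Hamiltonian cycles *)

(** A Hamiltonian cycle as its successor map, a one-orbit permutation; this form also admits [K2] as
    induction base. *)
Definition hamiltonian_succ (G : graph) (f : G -> G) :=
  [/\ injective f, forall x, adj x (f x) & forall x y, fconnect f x y].

Lemma hamiltonian_of_succ (G : graph) (f : G -> G) :
  hamiltonian_succ f -> 2 < #|G| -> hamiltonian G.
Proof.
case=> injf adjf conf G3; have [x _] := card_gt0P (vert_gt0 G).
have ox u : u \in orbit f x by rewrite -fconnect_orbit.
exists (orbit f x); split=> //.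
  by rewrite -(card_uniqP (orbit_uniq f x)) (eq_card (B := predT)).
apply: sub_cycle (cycle_orbit injf x) => u v /eqP <-.
exact: adjf.
Qed.

Section HamiltonianStep.
Variables (G : graph) (f : G -> G).
Hypothesis hf : hamiltonian_succ f.

Let at2 (a b : G) (j : bool) : exp_graph G K2 := (pair_at true a b, j).

Let at2E (v : exp_graph G K2) : v = at2 (v.1 true) (v.1 false) v.2.
Proof. by case: v => u j; rewrite /at2 (pair_at_eta true). Qed.

(* The layer of direction true over b is traversed along f from b to the
   f-predecessor p of b, then the layer of direction false over p from b to p,
   after which the layer of direction true over p is entered at p. *)
Let succ (v : exp_graph G K2) : exp_graph G K2 :=
  let a := v.1 true in let b := v.1 false in
  if v.2 then if f a == b then at2 a b false else at2 (f a) b true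
  else if a == b then at2 a b true else at2 a (f b) false.

Let succE a b j : succ (at2 a b j) =
  if j then if f a == b then at2 a b false else at2 (f a) b true
  else if a == b then at2 a b true else at2 a (f b) false.
Proof. by rewrite /succ /= !ffunE. Qed.

Let at2_inj a b j a' b' j' : at2 a b j = at2 a' b' j' -> [/\ a = a', b = b' & j = j'].
Proof.
move=> e; split; last exact: (congr1 snd e).
  by have := congr1 (fun v : exp_graph G K2 => v.1 true) e; rewrite /= !ffunE.
by have := congr1 (fun v : exp_graph G K2 => v.1 false) e; rewrite /= !ffunE.
Qed.

Lemma hamiltonian_succ_exp : exists g : exp_graph G K2 -> _, hamiltonian_succ g.
Proof.
have [injf adjf conf] := hf.
have inj : injective succ.
  move=> v v'; rewrite (at2E v) (at2E v').
  move: (v.1 true) (v.1 false) v.2 (v'.1 true) (v'.1 false) v'.2 => a b j a' b' j'.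
  rewrite !succE.
  case: j; case: j'; case: eqP => h; case: eqP => h' /at2_inj[] // e1 e2 _;
    subst; rewrite ?(injf _ _ e1) ?(injf _ _ e2) //.
  - by case: h'; apply: injf.
  - by case: h; apply: injf.
exists succ; split=> // [v|].
  rewrite (at2E v); move: (v.1 true) (v.1 false) v.2 => a b [] /=; rewrite succE; case: eqP => h.
  - exact: (adj_cross (pair_at true a b) true).
  - exact: etrans (adj_layer true b a (f a)) (adjf a).
  - exact: (adj_cross (pair_at true a b) false).
  - rewrite /at2 !(pair_atC false).
    exact: etrans (adj_layer false a b (f b)) (adjf b).
have step v : fconnect succ v (succ v) := fconnect1 succ v.
have row a b : fconnect succ (at2 b b true) (at2 a b true).
  rewrite -(iter_findex (conf b a)); elim: (findex _ _ _) => [|n IH] //=.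
  (* Once the iteration wraps round to [b], the target is the starting point itself. *)
  have [->|/negbTE ne] := eqVneq (f (iter n f b)) b; first exact: connect0.
  by apply: connect_trans IH _; have := step (at2 (iter n f b) b true); rewrite succE ne.
have col a b : fconnect succ (at2 a (f a) false) (at2 a b false).
  rewrite -(iter_findex (conf (f a) b)); elim: (findex _ _ _) => [|n IH] //=.
  have [<-|/negbTE ne] := eqVneq a (iter n f (f a)); first exact: connect0.
  by apply: connect_trans IH _; have := step (at2 a (iter n f (f a)) false); rewrite succE ne.
have turn a b : fconnect succ (at2 (f a) (f a) true) (at2 a b false).
  apply: connect_trans (row a (f a)) (connect_trans _ (col a b)).
  by have := step (at2 a (f a) true); rewrite succE eqxx.
(* The cycle visits the diagonal against [f], from [f a] to [a]; symmetry of [fconnect] for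
   injective [succ] reverses this. *)
have diagS a : fconnect succ (at2 a a true) (at2 (f a) (f a) true).
  rewrite fconnect_sym //; apply: connect_trans (turn a a) _.
  by have := step (at2 a a false); rewrite succE eqxx.
have diag a b : fconnect succ (at2 a a true) (at2 b b true).
  rewrite -(iter_findex (conf a b)); elim: (findex _ _ _) => [|n IH] //=.
  exact: connect_trans IH (diagS _).
have [c _] := card_gt0P (vert_gt0 G).
have all v : fconnect succ (at2 c c true) v.
  rewrite (at2E v); case: (v.2).
    exact: connect_trans (diag _ _) (row _ _).
  exact: connect_trans (diag _ _) (turn _ _).
by move=> v w; apply: connect_trans (all w); rewrite fconnect_sym.
Qed.
End HamiltonianStep.

(** * Distance and diameter *)

Section Distance.
Variable G : graph.

(** A walk is first shortened to a path without repetition, whose length lies in the range below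
    [#|G|] used by [dist]. *)
Lemma dist_le_size (x : G) p : path (@adj G) x p -> dist x (last x p) <= size p.
Proof.
case/shortenP => q xq uq sub.
have lt : size q < #|G| by rewrite -[_.+1]/(size (x :: q)) -(card_uniqP uq) max_card.
have le : size q <= size p.
  by apply: uniq_leq_size; [case/andP: uq|move=> z /sub].
apply: leq_trans le; rewrite /dist.
apply: (bigmin_le _ _ (i := Ordinal lt)); first exact: mem_index_enum.
by apply/existsP; exists (in_tuple q); rewrite xq /=.
Qed.

Lemma dist_path (x y : G) : connect (@adj G) x y ->
  exists p, [/\ path (@adj G) x p, last x p = y & size p = dist x y].
Proof.
case/connectP => p xp ->{y}; case/shortenP: xp => q xq uq _.
have lt : size q < #|G| by rewrite -[_.+1]/(size (x :: q)) -(card_uniqP uq) max_card.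
have := dist_le_size xq; rewrite /dist.
set y := last x q.
set P := fun n : 'I_#|G| => [exists p : n.-tuple G, path (@adj G) x p && (last x p == y)].
have [->|[n /existsP[t /andP[xt /eqP ty]] ->]] := bigmin_attained (index_enum _) P (@nat_of_ord _) #|G|.
  by rewrite leqNgt lt.
by exists t; split=> //; rewrite size_tuple.
Qed.

Lemma distxx (x : G) : dist x x = 0.
Proof. by apply/eqP; rewrite -leqn0; apply: (@dist_le_size x [::]). Qed.

Lemma dist_adj (x y z : G) : connected G -> adj x y -> dist x z <= (dist y z).+1.
Proof.
move=> conG xy; have [p [yp <- <-]] : exists p, [/\ path (@adj G) y p, last y p = z & size p = dist y z].
  by apply: dist_path; have /forallP/(_ y)/forallP := conG.
by apply: (@dist_le_size x (y :: p)); rewrite /= xy.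
Qed.

Lemma dist_le_diameter (x y : G) : dist x y <= diameter G.
Proof.
apply: leq_trans (leq_bigmax x).
exact: (leq_bigmax y).
Qed.

Lemma diameter_attained : exists x y : G, dist x y = diameter G.
Proof.
have [x ex] := eq_bigmax (fun x : G => \max_(y : G) dist x y) (vert_gt0 G).
have [y ey] := eq_bigmax (fun y : G => dist x y) (vert_gt0 G).
by exists x, y; rewrite /diameter ex ey.
Qed.

Definition reach n (x y : G) :=
  exists p, [/\ path (@adj G) x p, last x p = y & size p <= n].

Lemma reach_trans m n x y z : reach m x y -> reach n y z -> reach (m + n) x z.
Proof.
case=> p [xp <- pm] [q [yq <- qn]]; exists (p ++ q).
by rewrite cat_path xp yq last_cat size_cat leq_add.
Qed.

Lemma reach_diameter x y : connected G -> reach (diameter G) x y.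
Proof.
move=> /forallP/(_ x)/forallP/(_ y)/dist_path[p [xp py sp]].
by exists p; rewrite sp dist_le_diameter.
Qed.

End Distance.

Lemma diameter_exp (G : graph) :
  connected G -> 0 < diameter G ->
  diameter (exp_graph G K2) = (diameter G).*2 + 2.
Proof.
move=> conG D0; set D := diameter G.
have layerW (u w : {ffun K2 -> G}) (i : bool) : u (~~ i) = w (~~ i) ->
    reach D ((u, i) : exp_graph G K2) (w, i).
  move=> uw; have [p [xp py sp]] := reach_diameter (u i) (w i) conG.
  exists (map (layer i (u (~~ i))) p); rewrite size_map sp.
  rewrite -[(u, i)]layer_eta last_map py uw layer_eta -uw; split=> //.
  by rewrite path_map (eq_path (e' := @adj G)) // => y z; apply: adj_layer.
have crossW (u : {ffun K2 -> G}) (i : bool) : reach 1 ((u, i) : exp_graph G K2) (u, ~~ i).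
  by exists [:: ((u, ~~ i) : exp_graph G K2)]; split=> //; apply: (introT andP (conj (adj_cross u i) isT)).
have upper (v w : exp_graph G K2) : reach (D.*2 + 2) v w.
  (* The pair [m] has coordinate [i] already at its target: two layer walks and one cross edge
     suffice, plus a second cross edge if [j] is the initial direction. *)
  case: v w => u i [w j]; pose m := pair_at i (w i) (u (~~ i)).
  have h1 : reach D ((u, i) : exp_graph G K2) (m, i).
    by apply: layerW; rewrite pair_at_neg.
  have h2 : reach D ((m, ~~ i) : exp_graph G K2) (w, ~~ i).
    by apply: layerW; rewrite negbK pair_at_id.
  have h3 := reach_trans (reach_trans h1 (crossW m i)) h2.
  have [<-|ne] := eqVneq (~~ i) j.
    by case: h3 => p [? ? ?]; exists p; split=> //; lia.
  have := reach_trans h3 (crossW w (~~ i)).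
  have -> : ~~ ~~ i = j by case: (i) (j) ne => -[].
  by case=> p [? ? ?]; exists p; split=> //; lia.
apply/eqP; rewrite eqn_leq; apply/andP; split.
  apply/bigmax_leqP => v _; apply/bigmax_leqP => w _.
  have [p [vp <- sp]] := upper v w.
  exact: leq_trans (dist_le_size vp) sp.
have [x [y xy]] := diameter_attained G.
(* The last summand counts the changes of direction needed to reach
   (y, y; true). *)
pose phi (v : exp_graph G K2) := dist (v.1 true) y + dist (v.1 false) y +
  (if v.2 then if v.1 false == y then 0 else 2 else 1).
(* A layer edge changes one distance and keeps the last summand; a cross edge changes only the last
   summand, by one. *)
have phiS v w : adj v w -> phi v <= (phi w).+1.
  case: v w => u i [w j] /adj_expE[[-> [z uz ->]]|[-> ->]]; rewrite /phi /=.
    have := dist_adj y conG uz.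
    by case: (i) => /=; rewrite !ffunE /=; lia.
  by case: (i) => /=; case: eqP => [->|_]; rewrite ?distxx; lia.
have phi_path v p : path (@adj (exp_graph G K2)) v p -> phi v <= phi (last v p) + size p.
  elim: p v => [|w p IH] v /=; first by rewrite addn0.
  by case/andP => /phiS vw /IH wp; rewrite addnS; apply: leq_trans vw _; rewrite ltnS.
pose src : exp_graph G K2 := (pair_at true x x, true).
pose tgt : exp_graph G K2 := (pair_at true y y, true).
apply: leq_trans (dist_le_diameter src tgt).
have [q [sq qt _]] := upper src tgt.
have [|p [sp pt <-]] := @dist_path _ src tgt; first by apply/connectP; exists q.
(* [phi] is 0 at [tgt] and [D.*2 + 2] at [src], the 2 because [x] differs from [y] when [D] is
   positive. *)
have := phi_path _ _ sp; rewrite pt /phi /= !ffunE /= !distxx eqxx xy -/D.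
case: eqP => [xE|_]; last by lia.
by move: D0; rewrite -xy xE distxx.
Qed.

(** * Induction along the exponential cubes *)

Lemma exp_cubeS k : 0 < k -> exp_cube k.+1 = exp_graph (exp_cube k) K2.
Proof. by case: k. Qed.

Lemma exp_cube_invariants k : 0 < k ->
  [/\ regular (exp_cube k) k, #|exp_cube k| = 2 ^ (2 ^ k - 1),
      cut_bound (exp_cube k) k, exists f, hamiltonian_succ (G := exp_cube k) f &
      diameter (exp_cube k) = 3 * 2 ^ (k - 1) - 2].
Proof.
elim: k => // -[_ _|k /(_ isT) [reg card cut [f hf] diam] _].
  have regK : regular K2 1.
    by move=> u; rewrite -(cards1 (~~ u : K2)); apply: eq_card => v; rewrite !inE; case: u v => -[].
  split=> //.
  - by rewrite /= card_bool.
  - exact: cut_bound_K2.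
  - exists negb; split; [exact: can_inj negbK|by case|].
    move=> x y; have [<-|ne] := eqVneq x y; first exact: connect0.
    by apply: connect1; case: x y ne => -[].
  - have connK : connected K2 by apply: (@cut_bound_connected _ 1); last exact: cut_bound_K2.
    apply/eqP; rewrite eqn_leq; apply/andP; split.
      apply/bigmax_leqP => x _; apply/bigmax_leqP => y _.
      have [->|ne] := eqVneq x y; first by rewrite distxx.
      by apply: (@dist_le_size K2 x [:: y]); rewrite /= andbT.
    rewrite lt0n; apply/eqP => D0; have := dist_le_diameter (true : K2) (false : K2).
    rewrite D0; have [|[|z p] [//= _ _ <-]//] := @dist_path K2 true false.
    by have /forallP/(_ true)/forallP := connK.
(* Needed for [cut_bound_exp], where the degree must be below the order. *)
have ltk : k.+1 < #|exp_cube k.+1|.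
  by rewrite card; have := ltn_expl k.+1 (isT : 1 < 2); have := ltn_expl (2 ^ k.+1 - 1) (isT : 1 < 2); lia.
have pos : 0 < 2 ^ k by rewrite expn_gt0.
rewrite exp_cubeS //; split.
- exact: regular_exp.
- rewrite card_exp card -expnM -expnSr; congr (_ ^ _).
  by rewrite !expnS; lia.
- exact: cut_bound_exp.
- exact: hamiltonian_succ_exp hf.
- rewrite diameter_exp; last by rewrite diam !subn1 /=; lia.
    by rewrite diam !subn1 /= expnS; lia.
  exact: (@cut_bound_connected _ k.+1).
Qed.

Theorem mainTheorem9 (k : nat) (hk : 3 <= k) :
  [/\ maximally_connected (exp_cube k),
      super_edge_connected (exp_cube k) &
      regular (exp_cube k) k] /\
  [/\ hamiltonian (exp_cube k),
      #|exp_cube k| = 2 ^ (2 ^ k - 1) &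
      diameter (exp_cube k) = 3 * 2 ^ (k - 1) - 2].
Proof.
(* At [n = 1] both sides equal 2, hence the restriction. *)
have large n : 1 < n -> n.+1 < 2 ^ (2 ^ n - 1).
  case: n => [|[|n]] // _; have := ltn_expl n (isT : 1 < 2).
  by have := ltn_expl (2 ^ n.+2 - 1) (isT : 1 < 2); rewrite !expnS; lia.
have [|reg card cut [f hf] diam] := @exp_cube_invariants k; first by lia.
have ltk : k.+1 < #|exp_cube k| by rewrite card large //; lia.
split; split=> //.
- exact: (maximally_connected_regular reg).
(* The preceding cube is used, whose degree exceeds 1 because [3 <= k]. *)
- case: k hk {reg card cut f hf diam ltk} => // k hk.
  have [|reg card cut _ _] := @exp_cube_invariants k; first by lia.
  by rewrite exp_cubeS; [apply: super_edge_connected_exp reg cut; rewrite ?card ?large|]; lia.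
- by apply: hamiltonian_of_succ hf _; lia.
Qed.
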